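(* For every $r>0$ one has $\Gamma^{(r)}_{E(3;3;1,1,1)}=\mathcal B^{(r)}_{(3;3;1,1,1)}$, where $$\mathcal B^{(r)}_{(3;3;1,1,1)}=\{\mathbf x\in\mathbb C^7:\ 1-x_1z_1-x_2z_2+x_3z_1z_2-x_4z_3+x_5z_1z_3+x_6z_2z_3-x_7z_1z_2z_3\neq 0\ \text{ for all } (z_1,z_2,z_3)\in (r\mathbb D)^3\}.$$ In particular, $\Gamma_{E(3;3;1,1,1)}=\mathcal B^{(1)}_{(3;3;1,1,1)}$.
   Context: $\mathbb D$ is the open unit disc of $\mathbb C$ and $r\mathbb D=\{rz: z\in\mathbb D\}$. For a linear subspace $E$ of $\mathcal M_{n\times n}(\mathbb C)$ and $A\in\mathcal M_{n\times n}(\mathbb C)$, $\mu_E(A)=1/\inf\{\|X\|: X\in E,\ \det(I-AX)=0\}$, with $\mu_E(A)=0$ if $I-AX$ is nonsingular for all $X\in E$; $\|\cdot\|$ is the operator norm. $E(3;3;1,1,1)=\{\operatorname{diag}(z_1,z_2,z_3): z_1,z_2,z_3\in\mathbb C\}$. For $A=((a_{ij}))\in\mathcal M_{3\times 3}(\mathbb C)$ put $$\pi(A)=\big(a_{11},\ a_{22},\ a_{11}a_{22}-a_{12}a_{21},\ a_{33},\ a_{11}a_{33}-a_{13}a_{31},\ a_{22}a_{33}-a_{23}a_{32},\ \det A\big)\in\mathbb C^7.$$ For $r>0$, $\Gamma^{(r)}_{E(3;3;1,1,1)}=\{\pi(A): A\in \mathcal M_{3\times 3}(\mathbb C),\ \mu_{E(3;3;1,1,1)}(A)\le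 1/r\}$, and $\Gamma_{E(3;3;1,1,1)}=\Gamma^{(1)}_{E(3;3;1,1,1)}$. *)

(* Defs.v *)
From mathcomp Require Export all_boot all_order all_algebra.
From mathcomp Require Export all_classical all_reals.
From mathcomp Require Export complex.
Export Order.TTheory GRing.Theory Num.Theory.

Set Implicit Arguments.
Unset Strict Implicit.
Unset Printing Implicit Defensive.

Global Open Scope classical_set_scope.
Global Open Scope ring_scope.

(* The complex numbers are R[i], R being a realType; Normc.normc is the
   modulus with values in R. *)

Definition l2norm (R : realType) (n : nat) (v : 'cV[R[i]]_n) : R :=
  Num.sqrt (\sum_i Normc.normc (v i 0) ^+ 2).

(* The norm of 'M_n as operators on C^n with its Euclidean norm (the norm
   provided by the library on matrices is the entrywise maximum). *)
Definition opnorm (R : realType) (n : nat) (X : 'M[R[i]]_n) : R :=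
  sup [set l2norm (X *m v) | v in [set v : 'cV[R[i]]_n | l2norm v <= 1]].

Definition mu (R : realType) (n : nat) (E : {vspace 'M[R[i]]_n})
    (A : 'M[R[i]]_n) : R :=
  if `[< forall X, X \in E -> 1%:M - A *m X \in unitmx >] then 0
  else 1 / inf [set opnorm X
                 | X in [set X | X \in E /\ \det (1%:M - A *m X) = 0]].

(* The diagonal matrices, as the image of the linear map diag_mx. *)
Definition E111 (R : realType) : {vspace 'M[R[i]]_3} :=
  limg (linfun (@diag_mx R[i] 3)).

Lemma mem_E111 (R : realType) (X : 'M[R[i]]_3) :
  X \in E111 R <-> exists z : 'rV[R[i]]_3, X = diag_mx z.
Proof.
split=> [/memv_imgP[z _ ->]|[z ->]]; first by exists z; rewrite lfunE.
by rewrite -(lfunE (@diag_mx R[i] 3) z) memv_img ?memvf.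
Qed.

(* The k-th coordinate, with k counted from 1 *)
Definition coord1 (R : realType) (x : 'rV[R[i]]_7) (k : nat) : R[i] :=
  x 0 (inord k.-1).

Definition row7 (R : realType) (x1 x2 x3 x4 x5 x6 x7 : R[i]) : 'rV[R[i]]_7 :=
  \row_(k < 7) nth 0 [:: x1; x2; x3; x4; x5; x6; x7] k.

(* The (i, j) entry, with i and j counted from 1 *)
Definition entry1 (R : realType) (A : 'M[R[i]]_3) (i j : nat) : R[i] :=
  A (inord i.-1) (inord j.-1).

Definition piE (R : realType) (A : 'M[R[i]]_3) : 'rV[R[i]]_7 :=
  row7 (entry1 A 1 1)
       (entry1 A 2 2)
       (entry1 A 1 1 * entry1 A 2 2 - entry1 A 1 2 * entry1 A 2 1)
       (entry1 A 3 3)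
       (entry1 A 1 1 * entry1 A 3 3 - entry1 A 1 3 * entry1 A 3 1)
       (entry1 A 2 2 * entry1 A 3 3 - entry1 A 2 3 * entry1 A 3 2)
       (\det A).

Definition Gamma_r (R : realType) (r : R) : set 'rV[R[i]]_7 :=
  [set piE A | A in [set A | mu (E111 R) A <= 1 / r]].

Definition Gamma (R : realType) : set 'rV[R[i]]_7 := Gamma_r 1.
Arguments Gamma R : clear implicits.

Definition disc (R : realType) : set R[i] :=
  [set z | Normc.normc z < 1].
Arguments disc R : clear implicits.

Definition rdisc (R : realType) (r : R) : set R[i] :=
  [set r%:C%C * z | z in disc R].

Definition B_r (R : realType) (r : R) : set 'rV[R[i]]_7 :=
  [set x |
    forall z1 z2 z3, rdisc r z1 -> rdisc r z2 -> rdisc r z3 ->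
      1 - coord1 x 1 * z1 - coord1 x 2 * z2 + coord1 x 3 * z1 * z2
        - coord1 x 4 * z3 + coord1 x 5 * z1 * z3 + coord1 x 6 * z2 * z3
        - coord1 x 7 * z1 * z2 * z3 != 0].

(* Main.v *)
Require Import Defs.
From mathcomp Require Import ring.

Set Implicit Arguments.
Unset Strict Implicit.
Unset Printing Implicit Defensive.

(* Writing r for the radius, [mu (E111 R) A <= 1 / r] says that
   [det (I - A diag z)] does not vanish on the polydisc of radius r, and this
   determinant is the polynomial defining [B_r], evaluated at [piE A].  So it
   only remains to see that every point of C^7 is of the form [piE A].  The
   diagonal entries and the products p_ij = a_ij a_ji are prescribed, and the
   determinant then prescribes the sum c of the two 3-cycle products u and v,
   subject to u v = p_12 p_13 p_23.  Take u and v to be the roots of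
   t^2 - c t + p_12 p_13 p_23: if one of them is nonzero, a_12 = a_23 = 1 and
   a_31 = u will do; otherwise some p_ij is zero and we take
   a_ij = a_ji = 0. *)

(** * Operator norms of diagonal matrices *)

Section Diagonal.
Variables (R : realType) (n : nat).
Implicit Types (A : 'M[R[i]]_n) (v : 'cV[R[i]]_n) (z w : 'rV[R[i]]_n).

Lemma normc_ge0 (x : R[i]) : 0 <= Normc.normc x.
Proof. by case: x => a b; rewrite sqrtr_ge0. Qed.

Lemma normc_sum (I : finType) (F : I -> R[i]) :
  Normc.normc (\sum_i F i) <= \sum_i Normc.normc (F i).
Proof.
elim/big_ind2: _ => [|x a y b xa yb|//]; first by rewrite Normc.normc0.
exact: le_trans (le_normcD _ _) (lerD xa yb).
Qed.

Lemma l2norm_diag_le z v (M : R) : 0 <= M ->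
  (forall i, Normc.normc (z 0 i) <= M) ->
  l2norm (diag_mx z *m v) <= M * l2norm v.
Proof.
move=> M0 zM.
rewrite /l2norm -{1}(ger0_norm M0) -sqrtr_sqr -sqrtrM ?sqr_ge0 //.
rewrite ler_wsqrtr // mulr_sumr ler_sum // => i _.
rewrite mul_diag_mx mxE Normc.normcM exprMn ler_wpM2r ?sqr_ge0 //.
by rewrite lerXn2r ?nnegrE ?normc_ge0.
Qed.

Lemma l2norm_delta (i : 'I_n) : l2norm (delta_mx i 0 : 'cV[R[i]]_n) = 1.
Proof.
rewrite /l2norm (bigD1 i) //= mxE !eqxx Normc.normc1 expr1n big1 ?addr0 ?sqrtr1 //.
by move=> j /negPf ji; rewrite mxE ji Normc.normc0 expr0n.
Qed.

Lemma opnorm_diag_ub z (M : R) : 0 <= M ->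
  (forall i, Normc.normc (z 0 i) <= M) ->
  ubound [set l2norm (diag_mx z *m v) | v in [set v | l2norm v <= 1]] M.
Proof.
move=> M0 zM _ [v /= v1 <-].
apply: le_trans (l2norm_diag_le v M0 zM) _.
by rewrite -[leRHS]mulr1 ler_wpM2l.
Qed.

Lemma opnorm_diag_le z (M : R) : 0 <= M ->
  (forall i, Normc.normc (z 0 i) <= M) -> opnorm (diag_mx z) <= M.
Proof.
move=> M0 zM; apply: ge_sup; last exact: opnorm_diag_ub.
exists (l2norm (diag_mx z *m 0)), 0 => //=.
by rewrite /l2norm big1 ?sqrtr0 // => i _; rewrite mxE Normc.normc0 expr0n.
Qed.

Lemma normc_le_bigmax z i :
  Normc.normc (z 0 i) <= \big[Num.max/0]_j Normc.normc (z 0 j).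
Proof. exact: le_bigmax. Qed.

Lemma bigmax_normc_ge0 z : 0 <= \big[Num.max/0]_j Normc.normc (z 0 j).
Proof. exact: bigmax_ge_id. Qed.

(** Test on the i-th basis vector. With [opnorm_diag_le], this identifies the operator norm with the
    largest modulus on the diagonal. *)
Lemma normc_le_opnorm_diag z i : Normc.normc (z 0 i) <= opnorm (diag_mx z).
Proof.
apply: ub_le_sup.
  eexists; apply: (opnorm_diag_ub (bigmax_normc_ge0 z)) => j.
  exact: normc_le_bigmax.
exists (delta_mx i 0); first by rewrite /= l2norm_delta.
rewrite /l2norm (bigD1 i) //= mul_diag_mx !mxE !eqxx mulr1 big1 ?addr0.
  by rewrite sqrtr_sqr ger0_norm ?normc_ge0.
by move=> j /negPf ji; rewrite !mxE ji mulr0 Normc.normc0 expr0n.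
Qed.

(* Evaluate a left kernel vector at an entry of maximal modulus. *)
Lemma singular_diag_lower_bound A z : \det (1%:M - A *m diag_mx z) = 0 ->
  exists i, 1 <= Normc.normc (z 0 i) * \sum_j \sum_k Normc.normc (A j k).
Proof.
move=> /eqP/det0P[w w0]; rewrite mulmxBr mulmx1 => /subr0_eq wE.
have [i0 wi0] : exists i, w 0 i != 0 by apply/rV0Pn.
have [i _ wi] := arg_maxP (fun i => Normc.normc (w 0 i)) (erefl true : xpredT i0).
exists i.
have wi_gt0 : 0 < Normc.normc (w 0 i).
  apply: lt_le_trans (wi i0 isT); rewrite lt_neqAle normc_ge0 andbT eq_sym.
  by apply: contra wi0 => /eqP/Normc.eq0_normc->.
rewrite -(ler_pM2l wi_gt0) mulr1 {1}wE mulmxA mul_mx_diag mxE Normc.normcM.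
rewrite mulrC mulrCA ler_wpM2l ?normc_ge0 // mxE.
apply: le_trans (normc_sum _) _; rewrite mulr_sumr ler_sum // => j _.
rewrite Normc.normcM ler_pM ?normc_ge0 //; first exact: wi.
by rewrite (bigD1 i) //= lerDl sumr_ge0 // => *; rewrite normc_ge0.
Qed.

End Diagonal.

(** * The bound on [mu] as nonvanishing on a polydisc *)

Section Mu.
Variable R : realType.
Implicit Types (A : 'M[R[i]]_3) (z : 'rV[R[i]]_3) (r : R).

Lemma mu_E111_leP A r : 0 < r ->
  mu (E111 R) A <= 1 / r <->
  forall z, (forall i, Normc.normc (z 0 i) < r) ->
    \det (1%:M - A *m diag_mx z) != 0.
Proof.
move=> r0; rewrite /mu; case: ifPn => [/asboolP nsing|].
  split=> [_ z _|_]; last by rewrite divr_ge0 // ltW.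
  by have := nsing (diag_mx z); rewrite unitmxE unitfE; apply; apply/mem_E111; exists z.
move=> /asboolPn/existsNP[X0 /not_implyP[X0E /negP]].
rewrite unitmxE unitfE negbK => /eqP X0sing.
set S := [set opnorm X | X in _].
have S0 : S !=set0 by exists (opnorm X0), X0.
set K := \sum_j \sum_k Normc.normc (A j k).
have K0 : 0 <= K by apply: sumr_ge0 => ? _; apply: sumr_ge0 => *; apply: normc_ge0.
(* A positive lower bound forces [inf S] to be positive, so that taking inverses reverses the order;
   at 0 the convention 1 / 0 = 0 would break this. Adding 1 to [K] makes it invertible without a
   case distinction. *)
have Slb : lbound S (1 + K)^-1.
  move=> _ [X [/mem_E111[z ->] /singular_diag_lower_bound[i zi]] <-].
  apply: le_trans (normc_le_opnorm_diag z i).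
  rewrite -div1r ler_pdivrMr ?ltr_pwDl //; apply: le_trans zi _.
  by rewrite ler_wpM2l ?normc_ge0 // lerDr.
have m0 : 0 < inf S.
  by apply: lt_le_trans (lb_le_inf S0 Slb); rewrite invr_gt0 ltr_pwDl.
rewrite !div1r lef_pV2 //; split=> [rm z zr|nz].
  apply/negP => /eqP zsing.
  suff : r < r by rewrite ltxx.
  apply: le_lt_trans rm _.
  apply: (@le_lt_trans _ _ (opnorm (diag_mx z))).
    apply: ge_inf; first by exists (1 + K)^-1.
    by exists (diag_mx z) => //=; split => //; apply/mem_E111; exists z.
  (* A maximum of finitely many moduli below r is still strictly below r. *)
  apply: le_lt_trans (opnorm_diag_le (bigmax_normc_ge0 z) (normc_le_bigmax z)) _.
  exact: bigmax_lt.
apply: lb_le_inf => // _ [X [/mem_E111[z ->] zsing] <-].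
rewrite leNgt; apply/negP => zr; move/eqP: zsing; apply/negP/nz => i.
exact: le_lt_trans (normc_le_opnorm_diag z i) zr.
Qed.

End Mu.

(** * Determinants of order 3 and surjectivity of [piE] *)

Section Order3.

Lemma det_mx3 (F : comNzRingType) (A : 'M[F]_3) :
  let a i j := A (inord i) (inord j) in
  \det A = a 0 0 * a 1 1 * a 2 2 - a 0 0 * a 1 2 * a 2 1
         - a 0 1 * a 1 0 * a 2 2 + a 0 1 * a 1 2 * a 2 0
         + a 0 2 * a 1 0 * a 2 1 - a 0 2 * a 1 1 * a 2 0.
Proof.
move=> a; have aE i j : A i j = a i j by rewrite /a !inord_val.
rewrite (expand_det_row _ ord0) !big_ord_recl big_ord0 /cofactor.
rewrite !(expand_det_row _ ord0) !big_ord_recl !big_ord0 /cofactor !det_mx11 !mxE.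
by rewrite !aE /= /bump /=; ring.
Qed.

Variable R : realType.
Implicit Types (A : 'M[R[i]]_3) (z : 'rV[R[i]]_3).

Lemma coord1_row7 (x1 x2 x3 x4 x5 x6 x7 : R[i]) k : (k.-1 < 7)%N ->
  coord1 (row7 x1 x2 x3 x4 x5 x6 x7) k =
  nth 0 [:: x1; x2; x3; x4; x5; x6; x7] k.-1.
Proof. by move=> k7; rewrite /coord1 mxE inordK. Qed.

Lemma row7_coord1 (x : 'rV[R[i]]_7) :
  x = row7 (coord1 x 1) (coord1 x 2) (coord1 x 3) (coord1 x 4)
           (coord1 x 5) (coord1 x 6) (coord1 x 7).
Proof.
apply/rowP => k; rewrite mxE /coord1 -{1}(inord_val k).
by case: k => [] [|[|[|[|[|[|[|]]]]]]].
Qed.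

(** The coefficients of this determinant, as a polynomial in the diagonal entries, are the signed
    principal minors of A, which are the coordinates of [piE A]. *)
Lemma det_1_sub_mul_diag A z :
  let x := piE A in let t k := z 0 (inord k) in
  \det (1%:M - A *m diag_mx z) =
    1 - coord1 x 1 * t 0 - coord1 x 2 * t 1 + coord1 x 3 * t 0 * t 1
      - coord1 x 4 * t 2 + coord1 x 5 * t 0 * t 2 + coord1 x 6 * t 1 * t 2
      - coord1 x 7 * t 0 * t 1 * t 2.
Proof.
move=> x t; rewrite !coord1_row7 //= !det_mx3 /entry1 /t mul_mx_diag !mxE /=.
rewrite -!val_eqE /= !inordK //=; ring.
Qed.

Definition mx3 (a b c d e f g h k : R[i]) : 'M[R[i]]_3 :=
  \matrix_(i, j) nth 0 (nth [::] [:: [:: a; b; c]; [:: d; e; f]; [:: g; h; k]] i) j.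

Lemma piE_mx3 a b c d e f g h k :
  piE (mx3 a b c d e f g h k) =
  row7 a e (a * e - b * d) k (a * k - c * g) (e * k - f * h)
    (a * e * k - a * f * h - b * d * k + b * f * g + c * d * h - c * e * g).
Proof. by rewrite /piE det_mx3 /entry1 !mxE !inordK. Qed.

Lemma exists_sum_prod (c p : R[i]) : exists u v, u + v = c /\ u * v = p.
Proof.
(* Quadratic formula, with s a square root of the discriminant. *)
have sq := sqr_sqrtc (c ^+ 2 - 4 * p); set s := sqrtc _ in sq.
exists ((c + s) / 2), ((c - s) / 2); split; first by field.
have -> : p = (c ^+ 2 - s ^+ 2) / 4 by rewrite sq; field.
by field.
Qed.

Lemma piE_surj (x : 'rV[R[i]]_7) : exists A, piE A = x.
Proof.
rewrite (row7_coord1 x).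
move: (coord1 x 1) (coord1 x 2) (coord1 x 3) (coord1 x 4) (coord1 x 5)
  (coord1 x 6) (coord1 x 7) => x1 x2 x3 x4 x5 x6 x7.
(* The prescribed values of a_12 a_21, a_13 a_31 and a_23 a_32. *)
pose p := x1 * x2 - x3; pose q := x1 * x4 - x5; pose s := x2 * x4 - x6.
pose c := x7 - x1 * x2 * x4 + x1 * s + p * x4 + q * x2.
have [u [v [uvc uvp]]] := exists_sum_prod c (p * q * s).
(* Sum and product are symmetric, so u and v may be swapped. *)
wlog u0 : u v uvc uvp / u != 0 \/ u = 0 /\ v = 0.
  move=> th; have [u0|u0] := eqVneq u 0; last by apply: (th u v) => //; left.
  have [v0|v0] := eqVneq v 0; first by apply: (th u v) => //; right.
  by apply: (th v u); rewrite 1?addrC 1?mulrC //; left.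
have x3E : x3 = x1 * x2 - p by rewrite /p; ring.
have x5E : x5 = x1 * x4 - q by rewrite /q; ring.
have x6E : x6 = x2 * x4 - s by rewrite /s; ring.
have x7E : x7 = x1 * x2 * x4 - x1 * s - p * x4 - q * x2 + (u + v).
  by rewrite uvc /c; ring.
case: u0 => [u0|[u0 v0]].
  (* Once a_12 = a_23 = 1 and a_31 = u, the products force a_21 = p, a_32 = s and a_13 = q / u; the
     other 3-cycle product is then p q s / u = v. *)
  exists (mx3 x1 1 (q / u) p x2 1 u s x4); rewrite piE_mx3.
  have vE : v = p * q * s / u by rewrite -uvp; field.
  by congr row7; rewrite ?x3E ?x5E ?x6E ?x7E ?vE; field.
rewrite u0 v0 in uvp x7E.
(* Each 3-cycle product contains a_ij or a_ji for every pair, so setting both to 0 for one pair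
   makes both 3-cycle products vanish. *)
have /eqP := esym uvp; rewrite mul0r !mulf_eq0 -orbA => /or3P[] /eqP e0;
  rewrite e0 in x3E x5E x6E x7E.
- exists (mx3 x1 0 q 0 x2 1 1 s x4); rewrite piE_mx3.
  by congr row7; rewrite ?x3E ?x5E ?x6E ?x7E; ring.
- exists (mx3 x1 p 0 1 x2 1 0 s x4); rewrite piE_mx3.
  by congr row7; rewrite ?x3E ?x5E ?x6E ?x7E; ring.
- exists (mx3 x1 p q 1 x2 0 1 0 x4); rewrite piE_mx3.
  by congr row7; rewrite ?x3E ?x5E ?x6E ?x7E; ring.
Qed.

End Order3.

(** * Comparison of the two sets *)

Lemma rdiscE (R : realType) (r : R) (z : R[i]) : 0 < r ->
  rdisc r z <-> Normc.normc z < r.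
Proof.
move=> r0; have nr (s : R) : 0 <= s -> Normc.normc s%:C%C = s.
  by move=> s0; rewrite /Normc.normc /= expr0n addr0 sqrtr_sqr ger0_norm.
split=> [[w /= w1 <-]|zr].
  by rewrite Normc.normcM nr ?ltW // gtr_pMr.
have rC0 : r%:C%C != 0 :> R[i] by rewrite eq_complex /= eqxx andbT gt_eqF.
exists (z / r%:C%C); last by rewrite mulrC divfK.
by rewrite /disc /= Normc.normcM Normc.normcV nr ?ltW // ltr_pdivrMr ?mul1r.
Qed.

Lemma piE_mem_B_r (R : realType) (r : R) (A : 'M[R[i]]_3) : 0 < r ->
  B_r r (piE A) <-> mu (E111 R) A <= 1 / r.
Proof.
move=> r0; rewrite mu_E111_leP //; split=> [B z zr|nz z1 z2 z3].
  by rewrite det_1_sub_mul_diag; apply: B; apply/rdiscE.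
rewrite !rdiscE // => z1r z2r z3r.
have := nz (\row_k nth 0 [:: z1; z2; z3] k).
rewrite det_1_sub_mul_diag !mxE !inordK //; apply => i.
by rewrite mxE; case: i => [] [|[|[|]]].
Qed.

Theorem theorem2p1 (R : realType) :
  (forall r : R, 0 < r -> Gamma_r r = B_r r) /\ Gamma R = B_r 1.
Proof.
have GB (r : R) : 0 < r -> Gamma_r r = B_r r.
  move=> r0; apply/seteqP; split=> [_ [A /= muA <-]|x Bx].
    exact/piE_mem_B_r.
  (* Any preimage of x will do, since the bound on [mu] depends on A only through [piE A]. *)
  by have [A Ax] := piE_surj x; exists A => //=; apply/piE_mem_B_r; rewrite ?Ax.
by split=> //; apply: GB.
Qed.
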